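(* Let $f:\mathbb{R}^n\to\mathbb{R}$ be twice differentiable with $\nabla^2 f(x)\succeq \mu I_n$ and $\|\nabla^2 f(x)-\nabla^2 f(y)\|\le L\|x-y\|$ for all $x,y\in\mathbb{R}^n$, where $\mu,L>0$. Let $\sigma\in(0,1]$ and let $\omega,\xi$ be the singular value bounds of the prolongation operators defined in the context, with $0<\omega\le\xi<\infty$. Assume that the sequence $(x_k)_{k\in\mathbb{N}}$ is generated by the Adaptive Multilevel Newton method (defined in the context) with unit step sizes. Then, for any $k\in\mathbb{N}$, the following hold. 1. If $\xi\le 1$, then $$\|\nabla f(x_{k+1})\|\le \frac{L\xi^4}{2\sigma\mu^2\omega^4}\,\|\nabla f(x_k)\|^2 .$$ 2. If $\xi>1$, then $$\|\nabla f(x_{k+1})\|\le \frac{L\xi^5}{2\sigma\mu^2\omega^4}\,\|\nabla f(x_k)\|^2 .$$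
   Context: Here $\|\cdot\|$ is the Euclidean norm for vectors and the induced (spectral) norm for matrices; $A\succeq B$ means $A-B$ is positive semidefinite. Standing assumptions: $f$ is strictly convex and bounded below so that its minimizer over $\mathbb{R}^n$ exists. There are $m>1$ levels with dimensions $n_1<n_2<\cdots<n_{m-1}<n_m=n$. For each coarse level $1\le i\le m-1$ and each $k\in\mathbb{N}$, $R_{i,k}\in\mathbb{R}^{n_i\times n}$ has rank $n_i$ and $P_{i,k}:=R_{i,k}^\top$; at the fine level $R_{m,k}=P_{m,k}:=I_n$. Let $\sigma_1(P_{i,k})\ge\cdots\ge\sigma_{n_i}(P_{i,k})>0$ be the singular values of $P_{i,k}$. It is assumed that, over the coarse levels $1\le i\le m-1$ and $k\in\mathbb{N}$, $$\omega:=\inf_{i,k}\sigma_{n_i}(P_{i,k})>0,\qquad \xi:=\sup_{i,k}\sigma_1(P_{i,k})<\infty .$$ Adaptive Multilevel Newton method (unit step sizes $\alpha_k\equiv1$). Given $x_0\in\mathbb{R}^n$ and a parameter $\sigma\in(0,1]$, at each iteration $k=0,1,2,\ldots$ define for each $1\le i\le m$ the trial point $$x_{k+1}^{(i)}:=x_k-P_{i,k}\left(R_{i,k}\nabla^2 f(x_k)P_{i,k}\right)^{-1}R_{i,k}\nabla f(x_k),$$ (so $x_{k+1}^{(m)}=x_k-\nabla^2 f(x_k)^{-1}\nabla f(x_k)$ is the pure Newton step). Let $i^*$ be the smallest $i\in\{1,\ldots,m\}$ such that $$\|R_{i,k}\nabla f(x_k)\|\ge\sigma\|\nabla f(x_k)\|\quad\text{and}\quad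 \|R_{i,k}\nabla f(x_{k+1}^{(i)})\|\ge\sigma\|\nabla f(x_{k+1}^{(i)})\| ,$$ (the index $i=m$ always qualifies), and set $x_{k+1}:=x_{k+1}^{(i^* )}$. *)

(* Defs.v *)
From HB Require Import structures.
From mathcomp Require Import all_boot all_order all_algebra.
From mathcomp Require Import all_classical all_reals all_analysis.

Set Implicit Arguments.
Unset Strict Implicit.
Unset Printing Implicit Defensive.

Import Order.TTheory GRing.Theory Num.Theory.
Import numFieldNormedType.Exports.
Local Open Scope classical_set_scope.
Local Open Scope ring_scope.

(* The library's norm `|v| on matrices is the sup norm, hence the norms below.
   It induces the same topology, so [differentiable] is the usual notion. *)
Definition enorm (R : realType) (n : nat) (v : 'cV[R]_n) : R :=
  Num.sqrt (\sum_(i < n) v i 0 ^+ 2).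

Definition spectral_norm (R : realType) (p n : nat) (A : 'M[R]_(p, n)) : R :=
  sup [set enorm (A *m v) | v in [set v : 'cV[R]_n | enorm v <= 1]].

Definition psd (R : realType) (n : nat) (A : 'M[R]_n) : Prop :=
  A^T = A /\ forall v : 'cV[R]_n, 0 <= (v^T *m A *m v) 0 0.

(* The eigenvalues of A in nonincreasing order, repeated according to their
   multiplicity. The default [::] is only taken when the characteristic
   polynomial of A does not split over R, so never for a symmetric A. *)
Definition sorted_eigenvalues (R : realType) (n : nat) (A : 'M[R]_n) : seq R :=
  xget [::] [set s : seq R | sorted >=%R s /\
                             char_poly A = \prod_(a <- s) ('X - a%:P)].

(* j counts from 1, so that sigma_1(A) is the largest singular value. *)
Definition singular_value (R : realType) (p n : nat) (A : 'M[R]_(p, n))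
    (j : nat) : R :=
  Num.sqrt (nth 0 (sorted_eigenvalues (A^T *m A)) j.-1).

Definition gradient (R : realType) (n : nat) (f : 'cV[R]_n -> R)
    (x : 'cV[R]_n) : 'cV[R]_n :=
  \col_(i < n) 'D_(delta_mx i 0) f x.

Definition hessian (R : realType) (n : nat) (f : 'cV[R]_n -> R)
    (x : 'cV[R]_n) : 'M[R]_n :=
  \matrix_(i < n, j < n) 'D_(delta_mx j 0) ('D_(delta_mx i 0) f) x.

Definition twice_differentiable (R : realType) (n : nat)
    (f : 'cV[R]_n -> R) : Prop :=
  forall x : 'cV[R]_n, differentiable f x /\ differentiable (gradient f) x.

Definition strictly_convex (R : realType) (n : nat) (f : 'cV[R]_n -> R) : Prop :=
  forall (x y : 'cV[R]_n) (t : R), x != y -> 0 < t < 1 ->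
    f (t *: x + (1 - t) *: y) < t * f x + (1 - t) * f y.

(* Levels are indexed by 'I_q.+1, where q is the number of coarse levels:
   ord_max is the fine level and the indices i != ord_max are the coarse ones.
   The ambient dimension is n ord_max by definition. *)
Definition restrictions (R : realType) (q : nat) (n : 'I_q.+1 -> nat) : Type :=
  forall i : 'I_q.+1, nat -> 'M[R]_(n i, n ord_max).

Record multilevel (R : realType) (q : nat) (n : 'I_q.+1 -> nat)
    (Res : restrictions R n) : Prop := Multilevel {
  coarse_levels_exist : (0 < q)%N;
  dims_gt0 : forall i, (0 < n i)%N;
  dims_increasing : forall i j : 'I_q.+1, (i < j)%N -> (n i < n j)%N;
  coarse_full_rank : forall i k, i != ord_max -> \rank (Res i k) = n i;
  fine_identity : forall k, Res ord_max k = 1%:M }.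

(* Extended reals, so that the supremum of an unbounded family is +oo rather
   than a default real number. *)
Definition coarse_sigma_inf (R : realType) (q : nat) (n : 'I_q.+1 -> nat)
    (Res : restrictions R n) : \bar R :=
  ereal_inf [set (singular_value (Res l.1 l.2)^T (n l.1))%:E |
    l in [set l : 'I_q.+1 * nat | l.1 != ord_max]].

Definition coarse_sigma_sup (R : realType) (q : nat) (n : 'I_q.+1 -> nat)
    (Res : restrictions R n) : \bar R :=
  ereal_sup [set (singular_value (Res l.1 l.2)^T 1)%:E |
    l in [set l : 'I_q.+1 * nat | l.1 != ord_max]].

Definition trial_point (R : realType) (p n : nat) (f : 'cV[R]_n -> R)
    (r : 'M[R]_(p, n)) (x : 'cV[R]_n) : 'cV[R]_n :=
  x - r^T *m invmx (r *m hessian f x *m r^T) *m r *m gradient f x.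

Definition acceptable (R : realType) (p n : nat) (f : 'cV[R]_n -> R) (sigma : R)
    (r : 'M[R]_(p, n)) (x : 'cV[R]_n) : Prop :=
  let y := trial_point f r x in
  sigma * enorm (gradient f x) <= enorm (r *m gradient f x) /\
  sigma * enorm (gradient f y) <= enorm (r *m gradient f y).

Definition adaptive_multilevel_newton (R : realType) (q : nat)
    (n : 'I_q.+1 -> nat) (f : 'cV[R]_(n ord_max) -> R) (sigma : R)
    (Res : restrictions R n) (x : nat -> 'cV[R]_(n ord_max)) : Prop :=
  forall k : nat, exists i : 'I_q.+1,
    [/\ acceptable f sigma (Res i k) (x k),
        forall j : 'I_q.+1, acceptable f sigma (Res j k) (x k) -> (i <= j)%N
      & x k.+1 = trial_point f (Res i k) (x k)].

(* Main.v *)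
(* The step d = P (R H P)^-1 R g satisfies R H d = R g and <d, H d> = <d, g>, so
   strong convexity alone gives |d| <= |g| / mu. Hence
   R grad f(x - d) = R (grad f(x - d) - grad f(x) + H d), where the bracket is at
   most L |d|^2 / 2 by the Lipschitz condition, and |R v| <= xi |v|. The
   acceptance test then yields sigma |grad f(x - d)| <= c L |g|^2 / (2 mu^2) with
   c = xi on a coarse level and c = 1 on the fine one; both constants are
   dominated by the claimed ones since omega <= xi. *)

Require Import Defs.
From HB Require Import structures.
From mathcomp Require Import all_boot all_order all_algebra.
From mathcomp Require Import all_classical all_reals all_analysis.
From mathcomp Require Import ring lra.

Set Implicit Arguments.
Unset Strict Implicit.
Unset Printing Implicit Defensive.

Import Order.TTheory GRing.Theory Num.Theory.
Import numFieldNormedType.Exports.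
Local Open Scope classical_set_scope.
Local Open Scope ring_scope.

(** * Euclidean inner product and norm, Cauchy-Schwarz *)

Definition dot (R : realType) (n : nat) (u v : 'cV[R]_n) : R := (u^T *m v) 0 0.

Section InnerProduct.
Variables (R : realType) (n : nat).
Implicit Types (u v w : 'cV[R]_n) (a : R).

Lemma dotE u v : dot u v = \sum_i u i 0 * v i 0.
Proof. by rewrite /dot mxE; apply: eq_bigr => i _; rewrite mxE. Qed.

Lemma dotC u v : dot u v = dot v u.
Proof. by rewrite !dotE; apply: eq_bigr => i _; rewrite mulrC. Qed.

Lemma dotDr u v w : dot u (v + w) = dot u v + dot u w.
Proof. by rewrite /dot mulmxDr mxE. Qed.

Lemma dotZr u a v : dot u (a *: v) = a * dot u v.
Proof. by rewrite /dot -scalemxAr mxE. Qed.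

Lemma dotNr u v : dot u (- v) = - dot u v.
Proof. by rewrite -scaleN1r dotZr mulN1r. Qed.

Lemma dotDl u v w : dot (u + v) w = dot u w + dot v w.
Proof. by rewrite dotC dotDr !(dotC w). Qed.

Lemma dotZl a u v : dot (a *: u) v = a * dot u v.
Proof. by rewrite dotC dotZr dotC. Qed.

Lemma dotvv_ge0 v : 0 <= dot v v.
Proof. by rewrite dotE sumr_ge0 // => i _; rewrite -expr2 sqr_ge0. Qed.

Lemma dotvv_eq0 v : dot v v = 0 -> v = 0.
Proof.
rewrite dotE => /eqP; rewrite psumr_eq0 => [/allP v0|i _]; last first.
  by rewrite -expr2 sqr_ge0.
apply/colP => i; apply/eqP; rewrite mxE -sqrf_eq0 expr2.
by have := v0 i; rewrite mem_index_enum => /(_ isT).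
Qed.

Lemma enormE v : enorm v = Num.sqrt (dot v v).
Proof. by rewrite dotE. Qed.

Lemma enorm_ge0 v : 0 <= enorm v.
Proof. exact: sqrtr_ge0. Qed.

Lemma sqr_enorm v : enorm v ^+ 2 = dot v v.
Proof. by rewrite enormE sqr_sqrtr // dotvv_ge0. Qed.

Lemma enorm_eq0 v : enorm v = 0 -> v = 0.
Proof. by move=> v0; apply: dotvv_eq0; rewrite -sqr_enorm v0 expr0n. Qed.

Lemma enorm0 : enorm (0 : 'cV[R]_n) = 0.
Proof. by rewrite enormE /dot mulmx0 mxE sqrtr0. Qed.

Lemma enormZ a v : enorm (a *: v) = `|a| * enorm v.
Proof.
by rewrite !enormE dotZl dotZr mulrA -expr2 sqrtrM ?sqr_ge0 // sqrtr_sqr.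
Qed.

Lemma enorm_le v a : 0 <= a -> dot v v <= a ^+ 2 -> enorm v <= a.
Proof.
by move=> a0 va; rewrite -(@ler_pXn2r _ 2) ?nnegrE ?enorm_ge0 // sqr_enorm.
Qed.

End InnerProduct.

Lemma dot_mulmx (R : realType) (p n : nat) (A : 'M[R]_(p, n)) u v :
  dot u (A *m v) = dot (A^T *m u) v.
Proof. by rewrite /dot trmx_mul trmxK mulmxA. Qed.

(** Cauchy-Schwarz for a semidefinite form, by the discriminant of [q]. With [B = 1%:M] it is the
    usual inequality; a singular [B] is allowed because [rayleigh_eigenvalue] applies it to a form
    only known to be semidefinite. *)
Lemma sqr_bilinear_le (R : realType) (n : nat) (B : 'M[R]_n) (u w : 'cV[R]_n) :
  B^T = B -> (forall v, 0 <= dot v (B *m v)) ->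
  dot u (B *m w) ^+ 2 <= dot u (B *m u) * dot w (B *m w).
Proof.
move=> BT B0.
have q t s : 0 <= t ^+ 2 * dot u (B *m u) + 2 * t * s * dot u (B *m w) +
    s ^+ 2 * dot w (B *m w).
  have := B0 (t *: u + s *: w).
  rewrite mulmxDr -!scalemxAr !(dotDl, dotDr, dotZl, dotZr).
  rewrite [dot w (B *m u)]dot_mulmx BT [dot (B *m w) u]dotC.
  by congr (0 <= _); ring.
have a0 := B0 u; have c0 := B0 w.
move: q a0 c0; move: (dot u (B *m u)) (dot u (B *m w)) (dot w (B *m w)).
move=> a b c q a0 c0.
(* The choice [t = - b], [s = a] turns [q] into [a * (a * c - b ^+ 2)], and symmetrically in [c]. If
   both diagonal terms vanish, [q 1 (- b)] is [- 2 * b ^+ 2], which forces [b = 0]. *)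
have [a_gt0|a_le0] := ltP 0 a.
  by rewrite -subr_ge0 -(pmulr_rge0 _ a_gt0); move: (q (- b) a); nra.
have [c_gt0|c_le0] := ltP 0 c.
  by rewrite -subr_ge0 -(pmulr_rge0 _ c_gt0); move: (q c (- b)); nra.
by have := q 1 (- b); nra.
Qed.

Lemma dot_le_enorm (R : realType) (n : nat) (u v : 'cV[R]_n) :
  dot u v <= enorm u * enorm v.
Proof.
have := @sqr_bilinear_le R n 1%:M u v (trmx1 _ _).
rewrite !mul1mx -!sqr_enorm => /(_ (fun v => _)) cs.
have {}cs : dot u v ^+ 2 <= (enorm u * enorm v) ^+ 2.
  by rewrite exprMn; apply: cs => w; rewrite mul1mx dotvv_ge0.
apply: le_trans (ler_norm _) _.
rewrite -(@ler_pXn2r _ 2) ?nnegrE ?mulr_ge0 ?enorm_ge0 //.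
by rewrite real_normK ?num_real.
Qed.

(** * Operator norm, largest eigenvalue and largest singular value *)

(** A crude bound showing that the set under the [sup] of [spectral_norm] is bounded, so that this
    [sup] is a genuine one. Here [s] is the squared Frobenius norm; [1 + s] is positive and its
    square dominates [s]. *)
Lemma enorm_mulmx_bounded (R : realType) (p n : nat) (A : 'M[R]_(p, n)) :
  exists2 C, 0 < C & forall v, enorm (A *m v) <= C * enorm v.
Proof.
pose s := \sum_i dot (row i A)^T (row i A)^T.
have s0 : 0 <= s by apply: sumr_ge0 => i _; exact: dotvv_ge0.
exists (1 + s) => [|v]; first lra.
apply: enorm_le; first by rewrite mulr_ge0 ?enorm_ge0 //; lra.
rewrite exprMn sqr_enorm; apply: (@le_trans _ _ (s * dot v v)); last first.
  by apply: ler_wpM2r; [exact: dotvv_ge0|nra].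
rewrite dotE /s mulr_suml; apply: ler_sum => i _.
have -> : (A *m v) i 0 = dot (row i A)^T v.
  by rewrite dotE mxE; apply: eq_bigr => j _; rewrite !mxE.
rewrite -expr2; have := @sqr_bilinear_le R n 1%:M (row i A)^T v (trmx1 _ _).
by rewrite !mul1mx; apply => w; rewrite mul1mx dotvv_ge0.
Qed.

Lemma enorm_mulmx_le (R : realType) (p n : nat) (A : 'M[R]_(p, n)) v :
  enorm (A *m v) <= spectral_norm A * enorm v.
Proof.
have [C C0 AC] := enorm_mulmx_bounded A.
have [/enorm_eq0 ->|v0] := eqVneq (enorm v) 0.
  by rewrite mulmx0 !enorm0 mulr0.
have vgt0 : 0 < enorm v by rewrite lt_neqAle eq_sym v0 enorm_ge0.
rewrite -ler_pdivrMr // mulrC.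
have -> : (enorm v)^-1 * enorm (A *m v) = enorm (A *m ((enorm v)^-1 *: v)).
  by rewrite -scalemxAr enormZ ger0_norm // invr_ge0 enorm_ge0.
apply: ub_le_sup.
  exists C => _ [w /= w1 <-]; apply: le_trans (AC w) _.
  by rewrite ler_piMr // ltW.
exists ((enorm v)^-1 *: v) => //=.
by rewrite enormZ ger0_norm ?invr_ge0 ?enorm_ge0 // mulVf.
Qed.

(* If s is the supremum of the Rayleigh quotient and s - S were invertible, the
   positive semidefinite s - S would be coercive, contradicting the choice
   of s. *)
Lemma rayleigh_eigenvalue (R : realType) (p : nat) (S : 'M[R]_p) :
  (0 < p)%N -> S^T = S ->
  exists2 s, eigenvalue S s & forall v, dot v (S *m v) <= s * dot v v.
Proof.
case: p S => // p S _ ST.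
have [C C0 SC] := enorm_mulmx_bounded S.
pose E := [set dot v (S *m v) | v in [set v : 'cV[R]_p.+1 | enorm v = 1]].
have Eub : ubound E C.
  move=> _ [v /= v1 <-]; apply: le_trans (dot_le_enorm _ _) _.
  by have := SC v; rewrite v1; lra.
have E0 : E !=set0.
  exists (dot (delta_mx 0 0) (S *m delta_mx 0 0)), (delta_mx 0 0) => //=.
  rewrite enormE dotE (bigD1 0) //= big1 ?addr0 => [|i i0].
    by rewrite !mxE !eqxx mulr1 sqrtr1.
  by rewrite !mxE (negbTE i0) mul0r.
have Esup : has_sup E by split => //; exists C.
have sle v : dot v (S *m v) <= sup E * dot v v.
  have [/enorm_eq0 ->|v0] := eqVneq (enorm v) 0.
    by rewrite mulmx0 /dot !mulmx0 mxE mulr0.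
  have vgt0 : 0 < enorm v by rewrite lt_neqAle eq_sym v0 enorm_ge0.
  have : dot ((enorm v)^-1 *: v) (S *m ((enorm v)^-1 *: v)) <= sup E.
    apply: ub_le_sup; first by exists C.
    exists ((enorm v)^-1 *: v) => //=.
    by rewrite enormZ ger0_norm ?invr_ge0 ?enorm_ge0 // mulVf.
  rewrite -scalemxAr dotZl dotZr mulrA -expr2 exprVn mulrC ler_pdivrMr.
    by rewrite sqr_enorm.
  by rewrite exprn_gt0.
exists (sup E) => //.
rewrite /eigenvalue /eigenspace kermx_eq0 row_free_unit.
apply/negP => Bunit.
pose B := (sup E)%:M - S.
have {}Bunit : B \in unitmx.
  by rewrite /B -opprB -scaleN1r unitmxZ // unitrN1.
have BE v : B *m v = sup E *: v - S *m v.
  by rewrite mulmxBl mul_scalar_mx.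
have BT : B^T = B by rewrite /B linearB /= ST tr_scalar_mx.
have B0 v : 0 <= dot v (B *m v).
  by rewrite BE dotDr dotNr dotZr subr_ge0 sle.
have [K K0 BK] := enorm_mulmx_bounded B.
have [M M0 BM] := enorm_mulmx_bounded (invmx B).
have coer v : dot v v <= M ^+ 2 * K * dot v (B *m v).
  (* Cauchy-Schwarz for the form of [B], applied to [v] and [B *m v], bounds the square of the left
     side by [dot v (B *m v) * (K * enorm (B *m v) ^+ 2)]; one factor [enorm (B *m v) ^+ 2]
     cancels. *)
  have h1 : dot (B *m v) (B *m v) <= K * dot v (B *m v).
    have := sqr_bilinear_le v (B *m v) BT B0.
    rewrite [dot v (B *m (B *m v))]dot_mulmx BT.
    have := dot_le_enorm (B *m v) (B *m (B *m v)).
    have := BK (B *m v); have := enorm_ge0 (B *m v).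
    have := B0 v; rewrite -sqr_enorm.
    move: (enorm (B *m v)) (enorm (B *m (B *m v))) (dot v (B *m v)).
    move: (dot (B *m v) (B *m (B *m v))) => b e e' a a0 e0 e'K be h.
    have [->|e_neq0] := eqVneq e 0; first by rewrite expr0n mulr_ge0 // ltW.
    have e_gt0 : 0 < e ^+ 2 by rewrite exprn_even_gt0.
    rewrite -(ler_pM2r e_gt0) -expr2; apply: le_trans h _.
    rewrite (mulrC K) -mulrA; apply: ler_wpM2l => //; nra.
  have h2 : dot v v <= M ^+ 2 * dot (B *m v) (B *m v).
    rewrite -!sqr_enorm -exprMn ler_pXn2r ?nnegrE ?enorm_ge0 //.
      by have := BM (B *m v); rewrite mulKmx.
    by rewrite mulr_ge0 ?enorm_ge0 // ltW.
  by apply: le_trans h2 _; rewrite -mulrA ler_wpM2l ?sqr_ge0.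
have MK0 : 0 < M ^+ 2 * K by rewrite mulr_gt0 ?exprn_gt0.
(* A unit vector whose Rayleigh quotient is within [1 / (M ^+ 2 * K)] of the supremum; coercivity
   keeps every unit vector at least that far away. *)
have [_ [w /= w1 <-] hw] := sup_adherent (divr_gt0 ltr01 MK0) Esup.
have cv : 1 <= M ^+ 2 * K * (sup E - dot w (S *m w)).
  have := coer w; rewrite BE dotDr dotNr dotZr.
  by rewrite -[dot w w]sqr_enorm w1 expr1n mulr1.
have : sup E - dot w (S *m w) < 1 / (M ^+ 2 * K) by lra.
by rewrite ltr_pdivlMr // mulrC => lt1; move: (le_lt_trans cv lt1); rewrite ltxx.
Qed.

(* A nonzero singular value rules out the default [::] of [sorted_eigenvalues],
   so the characteristic polynomial of [A^T *m A] splits and the top eigenvalue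
   given by [rayleigh_eigenvalue] is on the list. *)
Lemma enorm_trmx_le_singular_value (R : realType) (n p : nat)
    (A : 'M[R]_(n, p)) (v : 'cV[R]_n) : (0 < p)%N ->
  0 < singular_value A p -> enorm (A^T *m v) <= singular_value A 1 * enorm v.
Proof.
move=> p0 sp0; rewrite /singular_value /=.
set s := sorted_eigenvalues (A^T *m A).
have sn0 : s <> [::].
  by move=> s0; move: sp0; rewrite /singular_value -/s s0 nth_nil sqrtr0 ltxx.
have [ssort schar] : sorted >=%R s /\
    char_poly (A^T *m A) = \prod_(a <- s) ('X - a%:P).
  by move: sn0; rewrite /s /sorted_eigenvalues; case: xgetP => [? -> []|].
have ST : (A^T *m A)^T = A^T *m A by rewrite trmx_mul trmxK.
have [l leig lmax] := rayleigh_eigenvalue p0 ST.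
have ls : l \in s by rewrite -root_prod_XsubC -schar -eigenvalue_root_char.
have l_le : l <= nth 0 s 0.
  move: ls ssort; case: s {sn0 schar} => //= b s.
  rewrite inE => /predU1P[->//|ls] bs.
  by have /allP/(_ l ls) := order_path_min ge_trans bs.
(* [Num.sqrt] sends negative numbers to 0, so squaring it back requires this sign. A negative top
   eigenvalue would make the form of [A^T *m A] negative on a basis vector. *)
have top0 : 0 <= nth 0 s 0.
  have [//|lt0] := leP 0 (nth 0 s 0).
  have v1 := lmax (delta_mx (Ordinal p0) 0).
  have := dotvv_ge0 (A *m delta_mx (Ordinal p0) 0).
  rewrite dot_mulmx mulmxA dotC => d0.
  have : dot (delta_mx (Ordinal p0) 0 : 'cV[R]_p) (delta_mx (Ordinal p0) 0) = 1.
    rewrite dotE (bigD1 (Ordinal p0)) //= big1 ?addr0 => [|i i0].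
      by rewrite !mxE !eqxx mulr1.
    by rewrite !mxE (negbTE i0) mul0r.
  by move=> d1; move: v1 (le_trans d0 v1); rewrite d1; lra.
have Ale u : enorm (A *m u) <= Num.sqrt (nth 0 s 0) * enorm u.
  apply: enorm_le; first by rewrite mulr_ge0 ?sqrtr_ge0 ?enorm_ge0.
  rewrite exprMn sqr_sqrtr // sqr_enorm dot_mulmx mulmxA dotC.
  by apply: le_trans (lmax u) _; rewrite ler_wpM2r ?dotvv_ge0.
(* Duality carries the bound from [A] to [A^T]: [enorm (A^T *m v) ^+ 2] is the product of
   [A *m (A^T *m v)] with [v], and one factor [enorm (A^T *m v)] cancels. *)
have [->|Av0] := eqVneq (enorm (A^T *m v)) 0.
  by rewrite mulr_ge0 ?sqrtr_ge0 ?enorm_ge0.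
have Avgt0 : 0 < enorm (A^T *m v) by rewrite lt_neqAle eq_sym Av0 enorm_ge0.
rewrite -(ler_pM2r Avgt0) -expr2 sqr_enorm dot_mulmx trmxK.
apply: le_trans (dot_le_enorm _ _) _.
by rewrite mulrAC ler_wpM2r ?enorm_ge0.
Qed.

(** * Derivatives along lines and the Taylor estimate for the gradient *)

Lemma derive_gradient (R : realType) (n : nat) (f : 'cV[R]_n -> R) x d :
  differentiable (gradient f) x -> 'D_d (gradient f) x = hessian f x *m d.
Proof.
move=> dG; rewrite deriveE // {1}[d]matrix_sum_delta linear_sum.
apply/colP => i; rewrite !mxE summxE; apply: eq_bigr => j _.
rewrite big_ord1 linearZ /= -deriveE // !mxE mulrC; congr (_ * _).
rewrite derive_mx; last exact: diff_derivable.
by rewrite mxE; congr ('D__ _ _); apply/funext => y; rewrite mxE.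
Qed.

Lemma is_derive_along (R : realType) (V W : normedModType R) (F : V -> W)
    (x v : V) (t : R) : derivable F (x + t *: v) v ->
  is_derive t (1 : R) (fun s : R => F (x + s *: v)) ('D_v F (x + t *: v)).
Proof.
have E : (fun h : R => h^-1 *: (F (x + (h *: (1 : R) + t) *: v) -
    F (x + t *: v))) =
  (fun h => h^-1 *: (F (h *: v + (x + t *: v)) - F (x + t *: v))).
  apply/funext => h; congr (_ *: (F _ - _)).
  by rewrite scaler1 scalerDl addrCA.
by move=> dF; split; rewrite /derivable /derive /= E.
Qed.

Lemma is_derive_dot (R : realType) (n : nat) (w : 'cV[R]_n)
    (F : R -> 'cV[R]_n) t dF : is_derive t (1 : R) F dF ->
  is_derive t (1 : R) (fun s => dot w (F s)) (dot w dF).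
Proof.
move=> [Fd <-]; rewrite (derive_mx Fd) dotE.
have -> : (fun s => dot w (F s)) = \sum_i (w i 0 *: (fun s => F s i 0)).
  by apply/funext => s; rewrite dotE fct_sumE.
apply: is_derive_sum => i; rewrite mxE; apply: is_deriveZ.
by apply: DeriveDef => //; exact: (derivable_mxP F t 1).1.
Qed.

(** The mean value theorem fails for vector functions, so the error [e] is paired with itself: the
    scalar function [phi] on the segment from [x] to [x - d] carries a correction [K * t ^+ 2] that
    makes it nonincreasing there. This gives the sharp factor 1/2 without integration. *)
Lemma gradient_taylor_le (R : realType) (n : nat) (f : 'cV[R]_n -> R) (L : R) x d :
  (forall y, differentiable (gradient f) y) ->
  (forall y z, spectral_norm (hessian f y - hessian f z) <= L * enorm (y - z)) ->
  enorm (gradient f (x - d) - gradient f x + hessian f x *m d) <=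
    L / 2 * enorm d ^+ 2.
Proof.
move=> dG lip; set e := (X in enorm X).
have [e0|e_neq0] := eqVneq (enorm e) 0.
  (* Only nonnegativity of the right side remains. The sign of [L] is not given, but the Lipschitz
     bound between [x + d] and [x] yields it when [d] is nonzero. *)
  have [->|d_neq0] := eqVneq d 0.
    by rewrite e0 enorm0 expr0n mulr0.
  have dgt0 : 0 < enorm d.
    rewrite lt_neqAle enorm_ge0 andbT eq_sym.
    by apply: contraNneq d_neq0 => /enorm_eq0 ->.
  have := le_trans (le_trans (enorm_ge0 _) (enorm_mulmx_le _ d))
    (ler_wpM2r (enorm_ge0 d) (lip (x + d) x)).
  by rewrite addrC addKr e0; nra.
have egt0 : 0 < enorm e by rewrite lt_neqAle eq_sym e_neq0 enorm_ge0.
(* [K] is the claimed bound times [enorm e]. Its term [2 * K * t] in [dphi] absorbs the Hessian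
   variation at distance [t * enorm d], and [phi 1 - phi 0] equals [dot e e - K]. *)
pose K := L / 2 * enorm e * enorm d ^+ 2.
pose phi (t : R) := dot e (gradient f (x + t *: (- d))) +
  (t * dot e (hessian f x *m d) - K * t ^+ 2).
pose dphi (t : R) := dot e (hessian f (x + t *: (- d)) *m (- d)) +
  (dot e (hessian f x *m d) - K * (2 * t)).
have phiD t : is_derive t (1 : R) phi (dphi t).
  have GD : is_derive t (1 : R) (fun s => gradient f (x + s *: (- d)))
      (hessian f (x + t *: (- d)) *m (- d)).
    rewrite -(derive_gradient (- d) (dG _)).
    exact: (is_derive_along (diff_derivable (dG _))).
  have qD : is_derive t (1 : R)
      (fun s : R => s * dot e (hessian f x *m d) - K * s ^+ 2)
      (dot e (hessian f x *m d) - K * (2 * t)).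
    by apply: is_derive_eq; rewrite /GRing.scale /=; ring.
  exact: (is_deriveD (is_derive_dot e GD) qD).
have phiC : {within `[0, 1], continuous phi}.
  by apply: derivable_within_continuous => t _; exact: ex_derive.
have [c] := MVT ltr01 (fun t _ => phiD t) phiC.
rewrite in_itv /= => /andP[c0 c1].
rewrite subr0 mulr1 => phi10.
have dphi_le : dphi c <= 0.
  rewrite /dphi; set z := x + _.
  have xz : enorm (x - z) = c * enorm d.
    by rewrite opprD addNKr scalerN opprK enormZ gtr0_norm.
  have h1 := enorm_mulmx_le (hessian f x - hessian f z) d.
  have h2 := ler_wpM2r (enorm_ge0 d) (lip x z).
  have h3 := dot_le_enorm e ((hessian f x - hessian f z) *m d).
  move: (le_trans h3 (ler_wpM2l (enorm_ge0 e) (le_trans h1 h2))).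
  rewrite xz /K; move: (hessian f x) (hessian f z) (e) => A B w.
  rewrite mulmxBl dotDr dotNr mulmxN dotNr.
  move: (dot w _) (dot w _) (enorm w) (enorm d) => a b u v; lra.
have eK : dot e e <= K.
  have -> : dot e e = phi 1 - phi 0 + K.
    by rewrite {2}/e !dotDr dotNr /phi scale0r scale1r addr0; ring.
  by rewrite phi10 gerDr.
rewrite -(ler_pM2l egt0) -expr2 [X in X <= _]sqr_enorm.
by have -> : enorm e * (L / 2 * enorm d ^+ 2) = K by rewrite /K; ring.
Qed.

(** * The Galerkin step and its length *)

(** A kernel vector of the coarse matrix prolongs to some [v] with [dot v (H *m v) = 0]; coercivity
    gives [v = 0], and prolongation is injective. *)
Lemma galerkin_unitmx (R : realType) (p n : nat) (H : 'M[R]_n)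
    (r : 'M[R]_(p, n)) (mu : R) :
  0 < mu -> (forall v, mu * dot v v <= dot v (H *m v)) -> row_free r ->
  r *m H *m r^T \in unitmx.
Proof.
move=> mu0 Hmu rfree; rewrite -unitmx_tr -row_free_unit -kermx_eq0.
apply/rowV0P => u /sub_kermxP uA0.
apply: (row_free_inj rfree); rewrite mul0mx /=; apply/trmx_inj; rewrite trmx0.
apply: dotvv_eq0; apply/eqP; rewrite eq_le dotvv_ge0 andbT.
rewrite -(pmulr_rle0 _ mu0); apply: le_trans (Hmu _) _.
rewrite trmx_mul -dot_mulmx !mulmxA.
have -> : r *m H *m r^T *m u^T = 0.
  by apply: trmx_inj; rewrite trmx_mul trmxK uA0 trmx0.
by rewrite /dot mulmx0 mxE.
Qed.

Lemma galerkin_step (R : realType) (p n : nat) (H : 'M[R]_n)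
    (r : 'M[R]_(p, n)) (mu : R) (g : 'cV[R]_n) :
  0 < mu -> (forall v, mu * dot v v <= dot v (H *m v)) -> row_free r ->
  let d := r^T *m invmx (r *m H *m r^T) *m r *m g in
  r *m (H *m d) = r *m g /\ enorm d <= enorm g / mu.
Proof.
move=> mu0 Hmu rfree d.
have rHd : r *m (H *m d) = r *m g.
  by rewrite /d !mulmxA mulmxV ?mul1mx // (galerkin_unitmx mu0).
split=> //; rewrite ler_pdivlMr // mulrC.
have [->|d_neq0] := eqVneq (enorm d) 0; first by rewrite mulr0 enorm_ge0.
have dgt0 : 0 < enorm d by rewrite lt_neqAle eq_sym d_neq0 enorm_ge0.
rewrite -(ler_pM2r dgt0) -mulrA -expr2 sqr_enorm.
apply: le_trans (Hmu d) _.
suff -> : dot d (H *m d) = dot g d by exact: dot_le_enorm.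
(* Since [d] lies in the range of [r^T], pairing with it only sees [r *m v], so [H *m d] may be
   replaced by [g]. *)
have dP v : dot d v = dot (invmx (r *m H *m r^T) *m r *m g) (r *m v).
  by rewrite dot_mulmx /d !mulmxA.
by rewrite dP rHd -dP dotC.
Qed.

(** * One accepted step, and the final constants *)

Lemma acceptable_step_le (R : realType) (p n : nat) (f : 'cV[R]_n -> R)
    (mu L sigma c : R) (r : 'M[R]_(p, n)) (x : 'cV[R]_n) :
  0 < mu -> 0 < L -> 0 <= c ->
  (forall y, differentiable (gradient f) y) ->
  psd (hessian f x - mu%:M) ->
  (forall y z, spectral_norm (hessian f y - hessian f z) <= L * enorm (y - z)) ->
  row_free r -> (forall v, enorm (r *m v) <= c * enorm v) ->
  acceptable f sigma r x ->
  sigma * enorm (gradient f (trial_point f r x)) <=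
    c * (L / (2 * mu ^+ 2) * enorm (gradient f x) ^+ 2).
Proof.
move=> mu0 L0 c0 dG [_ Hpsd] lip rfree rc [_ /le_trans]; apply.
have Hmu v : mu * dot v v <= dot v (hessian f x *m v).
  have := Hpsd v; rewrite -mulmxA -/(dot _ _) mulmxBl mul_scalar_mx.
  by rewrite dotDr dotNr dotZr subr_ge0.
have [rHd dle] := galerkin_step (gradient f x) mu0 Hmu rfree.
rewrite /trial_point; set d := _ *m gradient f x in rHd dle *.
have -> : r *m gradient f (x - d) =
    r *m (gradient f (x - d) - gradient f x + hessian f x *m d).
  by rewrite mulmxDr mulmxBr rHd subrK.
apply: le_trans (rc _) _; apply: ler_wpM2l => //.
apply: le_trans (gradient_taylor_le _ _ dG lip) _.
have -> : L / (2 * mu ^+ 2) * enorm (gradient f x) ^+ 2 =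
    L / 2 * (enorm (gradient f x) / mu) ^+ 2 by field; rewrite gt_eqF.
apply: ler_wpM2l; first by rewrite divr_ge0 // ltW.
by rewrite ler_pXn2r // nnegrE ?enorm_ge0 // divr_ge0 ?enorm_ge0 // ltW.
Qed.

Lemma coarse_restriction_le (R : realType) (q : nat) (n : 'I_q.+1 -> nat)
    (Res : restrictions R n) (omega xi : R) i k v :
  multilevel Res -> i != ord_max -> 0 < omega ->
  coarse_sigma_inf Res = omega%:E -> coarse_sigma_sup Res = xi%:E ->
  enorm (Res i k *m v) <= xi * enorm v.
Proof.
move=> hRes ic omega0 homega hxi.
(* Positivity of [omega] enters here: it makes the smallest singular value nonzero, as the bound by
   the largest one requires. *)
have sn : 0 < singular_value (Res i k)^T (n i).
  apply: lt_le_trans omega0 _; rewrite -lee_fin -homega.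
  by apply: ereal_inf_lbound; exists (i, k).
have s1 : singular_value (Res i k)^T 1 <= xi.
  by rewrite -lee_fin -hxi; apply: ereal_sup_ubound; exists (i, k).
have := enorm_trmx_le_singular_value v (dims_gt0 hRes i) sn.
rewrite trmxK => /le_trans; apply.
by rewrite ler_wpM2r ?enorm_ge0.
Qed.

Theorem theorem4p2 (R : realType) (q : nat) (n : 'I_q.+1 -> nat)
    (Res : restrictions R n) (f : 'cV[R]_(n ord_max) -> R)
    (mu L sigma omega xi : R) (x : nat -> 'cV[R]_(n ord_max))
    (hRes : multilevel Res)
    (hconvex : strictly_convex f)
    (hbounded : has_lbound (range f))
    (hmin : exists z, forall y, f z <= f y)
    (hdiff : twice_differentiable f)
    (hmu : 0 < mu) (hL : 0 < L)
    (hstrong : forall y, psd (hessian f y - mu%:M))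
    (hlip : forall y z,
      spectral_norm (hessian f y - hessian f z) <= L * enorm (y - z))
    (hsigma : 0 < sigma <= 1)
    (homega : coarse_sigma_inf Res = omega%:E)
    (hxi : coarse_sigma_sup Res = xi%:E)
    (homegaxi : 0 < omega <= xi)
    (hx : adaptive_multilevel_newton f sigma Res x) :
  forall k : nat,
    (xi <= 1 ->
      enorm (gradient f (x k.+1)) <=
        L * xi ^+ 4 / (2 * sigma * mu ^+ 2 * omega ^+ 4)
        * enorm (gradient f (x k)) ^+ 2) /\
    (1 < xi ->
      enorm (gradient f (x k.+1)) <=
        L * xi ^+ 5 / (2 * sigma * mu ^+ 2 * omega ^+ 4)
        * enorm (gradient f (x k)) ^+ 2).
Proof.
move=> k; have [i [acc _ ->]] := hx k.
have [omega0 omega_xi] := andP homegaxi; have [sigma0 _] := andP hsigma.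
have xi0 := lt_le_trans omega0 omega_xi.
set g := enorm (gradient f (x k)); set g1 := enorm _.
have xiomega : 1 <= xi ^+ 4 / omega ^+ 4.
  by rewrite ler_pdivlMr ?exprn_gt0 // mul1r ler_pXn2r // nnegrE ltW.
pose Q := L / (2 * mu ^+ 2) * g ^+ 2.
have Q0 : 0 <= Q.
  by rewrite mulr_ge0 ?sqr_ge0 // divr_ge0 ?mulr_ge0 ?sqr_ge0 // ltW.
have step c : 0 <= c -> row_free (Res i k) ->
    (forall v, enorm (Res i k *m v) <= c * enorm v) -> sigma * g1 <= c * Q.
  move=> c0 rfree rc.
  exact: (acceptable_step_le hmu hL c0 (fun y => (hdiff y).2)
            (hstrong (x k)) hlip rfree rc acc).
have {step} : sigma * g1 <= Q \/ sigma * g1 <= xi * Q.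
  have [iE|ic] := eqVneq i ord_max; [left|right].
    rewrite -[Q]mul1r; apply: step; first exact: ler01.
      by rewrite iE (fine_identity hRes) row_free_unit unitmx1.
    by rewrite iE (fine_identity hRes) => v; rewrite mul1mx mul1r.
  apply: step; first exact: ltW.
    by rewrite /row_free (coarse_full_rank hRes k ic).
  by move=> v; exact: (coarse_restriction_le _ _ hRes ic omega0 homega hxi).
have conclude c C : c <= C -> sigma * g1 <= c * Q ->
    g1 <= C * L / (2 * sigma * mu ^+ 2) * g ^+ 2.
  move=> cC h; rewrite -(ler_pM2l sigma0).
  have -> : sigma * (C * L / (2 * sigma * mu ^+ 2) * g ^+ 2) = C * Q.
    by rewrite /Q; field; rewrite !gt_eqF.
  exact: le_trans h (ler_wpM2r Q0 cC).
have E e : L * xi ^+ e / (2 * sigma * mu ^+ 2 * omega ^+ 4) =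
    xi ^+ e / omega ^+ 4 * L / (2 * sigma * mu ^+ 2).
  by field; rewrite !gt_eqF.
(* The factor 1 or [xi] must stay below [xi ^+ e / omega ^+ 4]. For [xi <= 1] both are at most 1,
   hence [e = 4] suffices; for [1 < xi] the fifth power supplies the extra [xi] of a coarse step. *)
move=> h; split=> xi1; rewrite E; case: h => h.
- by apply: (conclude 1); rewrite ?mul1r.
- by apply: (conclude xi) => //; exact: le_trans xi1 xiomega.
- apply: (conclude 1); rewrite ?mul1r // exprS -mulrA.
  exact: le_trans xiomega (ler_peMl (le_trans ler01 xiomega) (ltW xi1)).
- apply: (conclude xi) => //; rewrite exprS -mulrA.
  exact: ler_peMr (ltW xi0) xiomega.
Qed.
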